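(* For every $n\geq 1$, corners in $\mathcal{T}_n$ are in bijection with runs of size $1$ in $\mathfrak{S}_n$. That is, there is a bijection between the set of pairs $(T,c)$, where $T\in\mathcal{T}_n$ and $c$ is a corner of $T$, and the set of pairs $(\sigma,k)$, where $\sigma\in\mathfrak{S}_n$, $k\in\{1,\dots,n\}$ and $(\sigma_k)$ is an ascending run of size $1$ of $\sigma$.
   Context: A diagram is a left-justified array of cells with $\lambda_1\geq\lambda_2\geq\cdots\geq\lambda_k$ cells in rows $1,\dots,k$ (top to bottom). A corner is a cell whose bottom and right edges both lie on the southeast border of the diagram (no cell of the diagram immediately to its right, none immediately below it); the corners of a tableau are the corners of its underlying diagram. A tree-like tableau is a filling of a diagram without empty rows or empty columns with points inside some cells (at most one per cell) such that: (1) the top left cell contains a point, called the root point; (2) for every non-root pointed cell $c$, there is either a pointed cell above $c$ in the same column, or a pointed cell to the left of $c$ in the same row (not necessarily adjacent), but not both; (3) every row and every column contains at least one pointed cell. Its size is its number of points; $\mathcal{T}_n$ is the set of tree-like tableaux of size $n$. $\mathfrak{S}_n$ is the set of permutations $\sigma=\sigma_1\cdots\sigma_n$ of $\{1,\dots,n\}$. With the convention $\sigma_0=n+1$ and $\sigma_{n+1}=0$, an ascending run of length (size) $r$ of $\sigma$ is a sequence $(\sigma_m,\dots,\sigma_{m+r-1})$ such that $\sigma_{m-1}>\sigma_m<\sigma_{m+1}<\cdots<\sigma_{m+r-1}>\sigma_{m+r}$. In particular $(\sigma_k)$ is a run of size $1$ iff $\sigma_{k-1}>\sigma_k>\sigma_{k+1}$.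 *)

(* Defs.v *)
From mathcomp Require Import all_boot all_fingroup.
Set Implicit Arguments.
Unset Strict Implicit.
Unset Printing Implicit Defensive.

(* A left-justified array of cells, some of them pointed, is given by its rows
   from top to bottom; each row lists its cells from left to right, [true]
   marking a pointed cell.  Rows and columns are numbered from 0. *)
Definition filling := seq (seq bool).

Section Tableau.
Variable T : filling.

Definition ncols := head 0 (shape T).

Definition cell (i j : nat) : bool := j < nth 0 (shape T) i.

Definition pointed (i j : nat) : bool := nth false (nth [::] T i) j.

(* The row lengths weakly decrease and no row is empty; the columns are the
   [j < ncols], so none of them is empty either. *)
Definition is_diagram : bool := sorted geq (shape T) && (0 \notin shape T).

Definition point_above (i j : nat) : bool := [exists i' : 'I_i, pointed i' j].

Definition point_left (i j : nat) : bool := [exists j' : 'I_j, pointed i j'].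

Definition is_tree_like : bool :=
  [&& is_diagram,
      pointed 0 0,
      [forall i : 'I_(size T), forall j : 'I_ncols,
         pointed i j && ((i : nat, j : nat) != (0, 0)) ==>
         (point_above i j (+) point_left i j)],
      [forall i : 'I_(size T), exists j : 'I_ncols, pointed i j]
    & [forall j : 'I_ncols, exists i : 'I_(size T), pointed i j]].

Definition npoints : nat := count id (flatten T).

Definition corner (c : nat * nat) : bool :=
  [&& cell c.1 c.2, ~~ cell c.1 c.2.+1 & ~~ cell c.1.+1 c.2].

End Tableau.

Definition tlt (n : nat) := {T : filling | is_tree_like T && (npoints T == n)}.

Definition tlt_corner (n : nat) :=
  {Tc : tlt n * (nat * nat) | corner (val Tc.1) Tc.2}.

Section Runs.
Variables (n : nat) (s : 'S_n).

(* The word s_0 s_1 ... s_n s_(n+1) with s_0 = n+1 and s_(n+1) = 0; positions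
   and values of 'S_n, which range over 0..n-1, are shifted by one. *)
Definition entry (k : nat) : nat :=
  if k is k'.+1 then oapp (fun i : 'I_n => (s i).+1) 0 (insub k') else n.+1.

(* (s_m, ..., s_(m+r-1)) is an ascending run of length r. *)
Definition is_run (m r : nat) : bool :=
  [&& 0 < m, 0 < r, m + r <= n.+1,
      entry m < entry m.-1,
      [forall i : 'I_r.-1, entry (m + i) < entry (m + i).+1]
    & entry (m + r) < entry (m + r).-1].

End Runs.

Definition run1 (n : nat) := {sk : 'S_n * nat | is_run sk.1 sk.2 1}.

(* Main.v *)
Require Import Defs.
From mathcomp Require Import all_boot all_fingroup.
From mathcomp Require Import zify.
From Stdlib Require Import FunctionalExtensionality.
Set Implicit Arguments.
Unset Strict Implicit.
Unset Printing Implicit Defensive.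

(* Both sets are counted.  Encode the south-east border of a diagram by a word
   in D (vertical step) and E (horizontal step), read from the north-east end;
   a tree-like tableau with n points has a border of length n+1.  Let Z(w) be
   the number of tree-like tableaux with border w.  A corner is a factor DE.  If
   its cell is empty it can be removed; if it is pointed, its point is alone in
   its row or alone in its column, which can be deleted.  Hence
     Z(uDEv) = Z(uEDv) + Z(uDv) + Z(uEv)   unless u and v are both empty.
   Summing over |u| = a and |v| = b, let g(a,b) be the sum of Z(uDv) and
   h(a,c,b), where moreover |t| = c, the sum of Z(uDtEv).  The relation gives
   g(a,b+1) - g(a+1,b) = sum of all Z over length a+b+1, whence
   g(a,b) = b (a+b-1)!, and h(a,c+1,b) - h(a,c,b+1) = g(a,c+1+b), whence
   h(a,0,b) = g(a,b+1) - b g(a,b).  There are h(a,0,n-1-a) corners at position a;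
   summing over a yields n!(n+4)/6 corners for n >= 2.  In a permutation, the
   first and the last letter are each a run of size 1 in n!/2 cases and any
   other letter in n!/6 cases, which makes the same total. *)

(** * Deleting a row or a column *)

Section Relations.
Implicit Types P Q : nat -> nat -> bool.

Definition above_in P i j := [exists i' : 'I_i, P i' j].
Definition left_in P i j := [exists j' : 'I_j, P i j'].

(** Points form a predicate on all pairs of naturals, so that transposing and deleting a row or
    column are mere reindexings. That points lie inside the diagram is stated separately, by
    [supported]. *)
Definition tree_like P R C :=
  [/\ P 0 0,
      forall i j, P i j -> (i, j) != (0, 0) -> above_in P i j (+) left_in P i j,
      forall i, i < R -> exists j, P i j
    & forall j, j < C -> exists i, P i j].

Definition transp P i j := P j i.

Lemma aboveP P i j : reflect (exists2 i', i' < i & P i' j) (above_in P i j).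
Proof.
apply: (iffP existsP) => [[k Pk]|[k lk Pk]]; first by exists k.
by exists (Ordinal lk).
Qed.

Lemma leftP P i j : reflect (exists2 j', j' < j & P i j') (left_in P i j).
Proof.
apply: (iffP existsP) => [[k Pk]|[k lk Pk]]; first by exists k.
by exists (Ordinal lk).
Qed.

Lemma tree_like_transp P R C : tree_like P R C -> tree_like (transp P) C R.
Proof.
case=> P0 Px Pr Pc; split => // i j Pij nz.
by rewrite addbC; apply: Px => //; apply: contraNneq nz => -[-> ->].
Qed.

(** The point at [(i, j)] is alone in its row and last in its column, so no other point has it above
    or to its left. Conversely, column [j] has a point before the insertion, which ends up above row
    [i]; so the new point has a point above and none to its left. *)
Lemma delete_row P R C i j :
    (forall j', P i j' = (j' == j)) -> (forall i', i < i' -> ~~ P i' j) ->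
    i <= R -> j < C ->
  tree_like P R.+1 C /\ above_in P i j
    <-> tree_like (fun i' j' => P (bump i i') j') R C.
Proof.
move=> Pi Pj iR jC; split=> [[[P0 Px Pr Pc] /aboveP[a ai Pa]]|[Q0 Qx Qr Qc]].
  have i0 : 0 < i by lia.
  split; first by rewrite /bump leqNgt i0.
  - move=> k l Pkl nz.
    have := Px _ _ Pkl; have -> : (bump i k, l) != (0, 0).
      apply: contraNneq nz => -[b0 ->].
      by rewrite [k](_ : _ = 0) //; move: b0; rewrite /bump; lia.
    move=> /(_ isT); congr (_ (+) _).
    apply/aboveP/aboveP => -[m mk Pm].
      have mi : m != i.
        apply/negP => /eqP mi; move: Pm; rewrite mi Pi => /eqP lj.
        by move: Pkl; rewrite lj (negPf (Pj _ _)) // -{1}mi.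
      exists (unbump i m); first by move: mk mi; rewrite /bump /unbump; lia.
      by rewrite unbumpKcond (negPf mi).
    by exists (bump i m) => //; move: mk; rewrite /bump; lia.
  - by move=> k kR; apply: Pr; rewrite /bump; lia.
  - move=> l lC; have [m Pm] := Pc _ lC.
    case: (eqVneq m i) => [mi|mi].
      move: Pm; rewrite mi Pi => /eqP ->; exists a.
      by rewrite /bump leqNgt ai.
    by exists (unbump i m); rewrite unbumpKcond (negPf mi).
have abv : above_in P i j.
  have [k Pk] := Qc _ jC; apply/aboveP; exists (bump i k) => //.
  rewrite ltnNge; apply/negP => ik; move: (Pj (bump i k)).
  by rewrite Pk ltn_neqAle ik neq_bump => /(_ isT).
have i0 : 0 < i by case/aboveP: abv => k; lia.
split=> //; split.
- by move: Q0; rewrite /bump leqNgt i0.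
- move=> k l Pkl nz; case: (eqVneq k i) => [ki|ki].
    move: Pkl nz; rewrite ki Pi => /eqP -> _; rewrite abv /=.
    by apply/leftP => -[m ml]; rewrite Pi; lia.
  have bk : bump i (unbump i k) = k by rewrite unbumpKcond (negPf ki).
  have := Qx (unbump i k) l; rewrite bk Pkl => /(_ isT).
  have -> : (unbump i k, l) != (0, 0).
    apply: contraNneq nz => -[k0 ->]; move: bk; rewrite k0 /bump leqNgt i0.
    by move=> <-.
  move=> /(_ isT); congr (_ (+) _); last by rewrite /left_in bk.
  apply/aboveP/aboveP => -[m mk Pm].
    by exists (bump i m) => //; move: mk; rewrite -{2}bk /bump /unbump; lia.
  have mi : m != i.
    apply/negP => /eqP mi; move: Pm; rewrite mi Pi => /eqP lj.
    by move: Pkl; rewrite lj (negPf (Pj _ _)) //; rewrite -mi.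
  exists (unbump i m); first by move: mk mi ki; rewrite /unbump; lia.
  by rewrite unbumpKcond (negPf mi).
- move=> k kR; case: (eqVneq k i) => [->|ki]; first by exists j; rewrite Pi.
  have [|l Pl] := Qr (unbump i k); first by move: kR ki; rewrite /unbump; lia.
  by exists l; move: Pl; rewrite unbumpKcond (negPf ki).
- by move=> l /Qc[k Pk]; exists (bump i k).
Qed.

Lemma delete_col P R C i j :
    (forall i', P i' j = (i' == i)) -> (forall j', j < j' -> ~~ P i j') ->
    i < R -> j <= C ->
  tree_like P R C.+1 /\ left_in P i j
    <-> tree_like (fun i' j' => P i' (bump j j')) R C.
Proof.
move=> Pj Pi iR jC.
have D := @delete_row (transp P) C R j i Pj Pi jC iR.
split=> [[/tree_like_transp tP lP]|/tree_like_transp tP].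
  by have /D/tree_like_transp := conj tP lP.
by have /D[/tree_like_transp] := tP.
Qed.

(* Every non-root point is the first of its row or the first of its column,
   but not both; the root is both. *)
Lemma card_points P R C : 0 < R -> 0 < C ->
    (forall i j, P i j -> (i < R) && (j < C)) -> tree_like P R C ->
  (\sum_(i < R) \sum_(j < C) P i j).+1 = R + C.
Proof.
move=> R0 C0 Pb [P0 Px Pr Pc].
(* This sum counts the elements of [p] without a smaller one: the minimum alone. *)
have first n (p : pred nat) : (forall k, p k -> k < n) -> (exists k, p k) ->
    \sum_(k < n) (p k && ~~ [exists k' : 'I_k, p k']) = 1.
  move=> pn ex; have pm := ex_minnP ex; case: pm => m pm mmin.
  have mn := pn _ pm.
  rewrite (bigD1 (Ordinal mn)) //= pm /= big1 => [|k km].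
    case: existsP => // -[[k km] /= /mmin]; lia.
  case pk: (p k) => //=; case: existsP => // nex; case: nex.
  have mk := mmin _ pk.
  have mk' : m < k.
    by rewrite ltn_neqAle mk andbT; apply: contra_neq km => mk'; apply: val_inj.
  by exists (Ordinal mk').
have rows : \sum_(i < R) \sum_(j < C) (P i j && ~~ left_in P i j) = R.
  rewrite -[RHS]card_ord -sum1_card; apply: eq_bigr => i _.
  by apply: first => [k /Pb/andP[]|]; last exact: Pr.
have cols : \sum_(i < R) \sum_(j < C) (P i j && ~~ above_in P i j) = C.
  rewrite exchange_big -[RHS]card_ord -sum1_card; apply: eq_bigr => j _.
  by apply: (@first _ (fun i => P i j)) => [k /Pb/andP[]|]; last exact: Pc.
apply/esym; rewrite -[LHS](congr2 addn rows cols) -big_split /=.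
have E i j : (P i j && ~~ left_in P i j) + (P i j && ~~ above_in P i j)
     = P i j + ((i, j) == (0, 0)).
  case: eqP => [[-> ->]|/eqP nz].
    have -> : left_in P 0 0 = false by case: (leftP P 0 0) => // -[k].
    have -> : above_in P 0 0 = false by case: (aboveP P 0 0) => // -[k].
    by rewrite P0.
  by case Pij: (P i j) => //=; have := Px _ _ Pij nz; do 2!case: (_ i j).
under eq_bigr => i _.
  rewrite -big_split /=; under eq_bigr => j _ do rewrite E.
  rewrite big_split /=; over.
rewrite big_split /= -addn1; congr (_ + _).
rewrite (bigD1 (Ordinal R0)) //= (bigD1 (Ordinal C0)) //= !big1 //.
  move=> i i0; rewrite big1 // => j _; case: eqP => // -[iz _].
  by move: i0; rewrite -val_eqE /= iz.
by move=> j j0; case: eqP => // -[jz]; move: j0; rewrite -val_eqE /= jz.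
Qed.

End Relations.

(** * Border words and tableaux *)

Section Words.
Implicit Types w u v x : seq bool.

Fixpoint words n : seq (seq bool) :=
  if n is n'.+1 then map (cons true) (words n') ++ map (cons false) (words n')
  else [:: [::]].

Lemma mem_words n w : (w \in words n) = (size w == n).
Proof.
elim: n w => [|n IH] [|b w] //=; rewrite mem_cat.
  by apply/orP => -[] /mapP[].
have inj c : injective (cons c : seq bool -> seq bool) by move=> ? ? [].
have no c c' : c != c' -> (c :: w \in map (cons c') (words n)) = false.
  by move=> cc; apply/mapP => -[? _ [ec _]]; rewrite ec eqxx in cc.
by case: b; rewrite mem_map // no // IH ?orbF.
Qed.

Lemma uniq_words n : uniq (words n).
Proof.
elim: n => //= n IH; rewrite cat_uniq !map_inj_uniq ?IH ?andbT //=; try by move=> ? ? [].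
by apply/hasPn => _ /mapP[w _ ->]; apply/mapP => -[].
Qed.

Lemma sum_words_cons n (F : seq bool -> nat) :
  \sum_(w <- words n.+1) F w =
  \sum_(w <- words n) F (true :: w) + \sum_(w <- words n) F (false :: w).
Proof. by rewrite big_cat !big_map. Qed.

Lemma sum_words_cat m n (F : seq bool -> nat) :
  \sum_(w <- words (m + n)) F w =
  \sum_(u <- words m) \sum_(v <- words n) F (u ++ v).
Proof.
elim: m F => [|m IH] F; first by rewrite big_seq1.
by rewrite addSn !sum_words_cons !IH.
Qed.

Lemma sum_words_rcons n (F : seq bool -> nat) :
  \sum_(w <- words n.+1) F w =
  \sum_(w <- words n) F (rcons w true) + \sum_(w <- words n) F (rcons w false).
Proof.
rewrite -addn1 sum_words_cat -big_split; apply: eq_bigr => u _.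
by rewrite sum_words_cons !big_seq1 !cats1.
Qed.

(* The south-east border of a diagram, followed from its north-east end to its
   south-west end, is a word in which [true] is the vertical step closing a row
   and [false] the horizontal step closing a column. *)
Definition nrow w := count id w.
Definition ncol w := count negb w.

Fixpoint border_shape w : seq nat :=
  if w is b :: w' then
    if b then ncol w' :: border_shape w' else border_shape w'
  else [::].

Definition wcell w i j := j < nth 0 (border_shape w) i.

Lemma nrow_cat u v : nrow (u ++ v) = nrow u + nrow v.
Proof. exact: count_cat. Qed.

Lemma ncol_cat u v : ncol (u ++ v) = ncol u + ncol v.
Proof. exact: count_cat. Qed.

Lemma nrow_ncol w : nrow w + ncol w = size w.
Proof. by rewrite -(count_predC id w). Qed.

Lemma size_border_shape w : size (border_shape w) = nrow w.
Proof. by elim: w => //= -[] w /= ->. Qed.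

Lemma nth_border_shape_le w i : nth 0 (border_shape w) i <= ncol w.
Proof.
elim: w i => [|[] w IH] i /=; first by rewrite nth_nil.
  by case: i => [|i] //=; exact: IH.
by apply: leq_trans (IH i) _; rewrite /ncol /= leqnSn.
Qed.

(** The border runs leftwards, so each row closed within [u] extends over all columns closed within
    [x]. *)
Lemma nth_border_shape_cat u x i :
  nth 0 (border_shape (u ++ x)) i =
  if i < nrow u then nth 0 (border_shape u) i + ncol x
  else nth 0 (border_shape x) (i - nrow u).
Proof.
elim: u i => [|[] u IH] i /=; first by rewrite subn0.
  by case: i => [|i] /=; rewrite ?ncol_cat // IH.
exact: IH.
Qed.

Lemma wcell_bound w i j : wcell w i j -> (i < nrow w) && (j < ncol w).
Proof.
rewrite /wcell => c; rewrite (leq_trans c (nth_border_shape_le _ _)) andbT.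
by rewrite -size_border_shape ltnNge; apply/negP => /(nth_default 0) e; rewrite e in c.
Qed.

Section Corner.
Variables u v : seq bool.
Let w := u ++ [:: true, false & v].
(** The factor [true, false] bounds the cell [(i, j)]: [nrow u] rows lie above it and [ncol v]
    columns to its left. *)
Let i := nrow u.
Let j := ncol v.

Let wE i' : nth 0 (border_shape w) i' =
  if i' < i then nth 0 (border_shape u) i' + j.+1
  else if i' == i then j.+1 else nth 0 (border_shape v) (i' - i).-1.
Proof.
rewrite nth_border_shape_cat -/i; case: ltnP => // ii.
by case: eqP => [->|ne]; rewrite ?subnn //; case e: (i' - i) => [|k] //=; lia.
Qed.

Lemma wcell_corner : wcell w i j.
Proof. by rewrite /wcell wE ltnn eqxx. Qed.

Lemma wcell_corner_row j' : wcell w i j' -> j' <= j.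
Proof. by rewrite /wcell wE ltnn eqxx. Qed.

Lemma wcell_corner_col i' : wcell w i' j -> i' <= i.
Proof.
rewrite /wcell wE; case: (leqP i' i) => // ii.
by rewrite [i' < i]ltnNge (ltnW ii) gtn_eqF //= ltnNge nth_border_shape_le.
Qed.

(** With its two steps exchanged, the border passes on the other side of the corner cell. *)
Lemma wcell_swap i' j' :
  wcell (u ++ [:: false, true & v]) i' j' = wcell w i' j' && ((i', j') != (i, j)).
Proof.
rewrite /wcell wE nth_border_shape_cat -/i xpair_eqE.
case: (ltngtP i' i) => //= ii; rewrite ?andbT //; last first.
  by rewrite ii subnn /=; rewrite -/(ncol v) -/j; lia.
by case e: (i' - i) => [|k] //=; lia.
Qed.

(** Dropping the vertical step of the corner deletes its row; [bump] jumps over the deleted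
    index. *)
Lemma wcell_del_row i' j' :
  wcell (u ++ false :: v) i' j' = wcell w (bump i i') j'.
Proof.
rewrite /wcell wE nth_border_shape_cat -/i /bump.
case: (ltnP i' i) => ii; first by rewrite add0n ii.
rewrite add1n !ifN; try lia.
by congr (_ < nth _ _ _); lia.
Qed.

Lemma wcell_del_col i' j' :
  wcell (u ++ true :: v) i' j' = wcell w i' (bump j j').
Proof.
rewrite /wcell wE nth_border_shape_cat -/i /bump.
case: (ltngtP i' i) => ii; first by rewrite /ncol /= -/(ncol v) -/j; lia.
  case e: (i' - i) => [|k] //=; first lia.
  by have := nth_border_shape_le v k; rewrite -/j; lia.
by rewrite ii subnn /= -/j; lia.
Qed.

End Corner.

(** * Tableaux with a given border, as fillings and as relations *)

Definition tree_likeb T R C :=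
  [&& pointed T 0 0,
      [forall i : 'I_R, forall j : 'I_C,
         pointed T i j && ((i : nat, j : nat) != (0, 0)) ==>
         (point_above T i j (+) point_left T i j)],
      [forall i : 'I_R, exists j : 'I_C, pointed T i j]
    & [forall j : 'I_C, exists i : 'I_R, pointed T i j]].

Definition supported w (P : nat -> nat -> bool) :=
  forall i j, P i j -> wcell w i j.

Definition border_tree_like w P := supported w P /\ tree_like P (nrow w) (ncol w).

Lemma tree_likebP T R C :
  (forall i j, pointed T i j -> (i < R) && (j < C)) ->
  reflect (tree_like (pointed T) R C) (tree_likeb T R C).
Proof.
move=> b; apply: (iffP and4P) => -[P0 Px Pr Pc]; split=> //.
- move=> i j Pij nz; have /andP[iR jC] := b _ _ Pij.
  have /forallP/(_ (Ordinal jC))/implyP := forallP Px (Ordinal iR).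
  by rewrite /= Pij nz => /(_ isT).
- move=> i iR; have /existsP[j Pj] := forallP Pr (Ordinal iR).
  by exists j.
- move=> j jC; have /existsP[i Pi] := forallP Pc (Ordinal jC).
  by exists i.
- apply/forallP => i; apply/forallP => j; apply/implyP => /andP[Pij nz].
  exact: Px.
- apply/forallP => i; have [j Pj] := Pr _ (ltn_ord i).
  by have /andP[_ jC] := b _ _ Pj; apply/existsP; exists (Ordinal jC).
- apply/forallP => j; have [i Pi] := Pc _ (ltn_ord j).
  by have /andP[iR _] := b _ _ Pi; apply/existsP; exists (Ordinal iR).
Qed.

Lemma pointed_cell T i j : pointed T i j -> cell T i j.
Proof.
rewrite /pointed /cell /shape => p.
have iT : i < size T.
  by rewrite ltnNge; apply/negP => h; rewrite (nth_default _ h) nth_nil in p.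
rewrite (nth_map [::]) // ltnNge; apply/negP => h.
by rewrite nth_default in p.
Qed.

Fixpoint fillings (sh : seq nat) : seq filling :=
  if sh is n :: sh' then [seq r :: T | r <- words n, T <- fillings sh']
  else [:: [::]].

Lemma mem_fillings sh T : (T \in fillings sh) = (shape T == sh).
Proof.
elim: sh T => [|n sh IH] [|r T] //=.
  by apply/allpairsP => -[[? ?] []].
rewrite eqseq_cons -mem_words -IH.
apply/allpairsP/andP => [[[r' T'] /= [rw Tf [-> ->]]] //|[rw Tf]].
by exists (r, T).
Qed.

Lemma uniq_fillings sh : uniq (fillings sh).
Proof.
elim: sh => //= n sh IH; apply: allpairs_uniq; rewrite ?uniq_words //.
by move=> [r T] [r' T'] _ _ /= [-> ->].
Qed.

(** The length of this list is the number $Z(w)$. *)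
Definition tlts w : seq filling :=
  [seq T <- fillings (border_shape w) | tree_likeb T (nrow w) (ncol w)].

Lemma uniq_tlts w : uniq (tlts w).
Proof. exact: filter_uniq (uniq_fillings _). Qed.

Lemma tltsP w T :
  reflect (shape T = border_shape w /\ border_tree_like w (pointed T))
          (T \in tlts w).
Proof.
rewrite mem_filter mem_fillings; case: eqP => [sT|?]; last first.
  by rewrite andbF; constructor => -[].
have supp : supported w (pointed T).
  by move=> i j /pointed_cell; rewrite /cell /wcell sT.
rewrite andbT; apply: (iffP (tree_likebP _)); last by case=> _ [].
  by move=> i j /supp/wcell_bound.
by split.
Qed.

Definition mkfilling (sh : seq nat) (P : nat -> nat -> bool) : filling :=
  mkseq (fun i => mkseq (P i) (nth 0 sh i)) (size sh).

Lemma shape_mkfilling sh P : shape (mkfilling sh P) = sh.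
Proof.
rewrite /shape -map_comp -[RHS](mkseq_nth 0); apply: eq_map => i /=.
by rewrite size_mkseq.
Qed.

Lemma pointed_mkfilling w P :
  supported w P -> pointed (mkfilling (border_shape w) P) = P.
Proof.
move=> supp; apply: functional_extensionality => i.
apply: functional_extensionality => j; rewrite /pointed.
(* Outside the array [pointed] yields its default [false], and the support condition makes [P] false
   there as well. *)
case: (ltnP i (size (border_shape w))) => iw; last first.
  rewrite [nth [::] _ _]nth_default ?size_mkseq // nth_nil; apply/esym.
  by apply/negP => /supp; rewrite /wcell nth_default.
rewrite nth_mkseq //; case: (ltnP j (nth 0 (border_shape w) i)) => jw.
  by rewrite nth_mkseq.
rewrite nth_default ?size_mkseq //; apply/esym/negP => /supp.
by rewrite /wcell ltnNge jw.
Qed.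

Lemma eq_filling T T' : shape T = shape T' -> pointed T = pointed T' -> T = T'.
Proof.
move=> sh pt; have sz : size T = size T' by have := congr1 size sh; rewrite !size_map.
apply: (eq_from_nth (x0 := [::])) => // i iT.
have rw : size (nth [::] T i) = size (nth [::] T' i).
  have := congr1 (fun s => nth 0 s i) sh; rewrite /shape !(nth_map [::]) -?sz //.
apply: (eq_from_nth (x0 := false)) => // j jT.
exact: (congr1 (fun P => P i j) pt).
Qed.

Lemma leq_size_transfer (X Y : eqType) (s : seq X) (t : seq Y) (f : X -> Y) g :
    uniq s -> {in s, forall a, f a \in t /\ g (f a) = a} ->
  size s <= size t.
Proof.
move=> us fP; rewrite -(size_map f); apply: uniq_leq_size.
  by rewrite map_inj_in_uniq // => x y /fP[_ {2}<-] /fP[_ {2}<-] ->.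
by move=> _ /mapP[a /fP[fa _] ->].
Qed.

(** Corner removals are inverse maps between relations; [mkfilling] carries them to fillings, and
    each direction gives one inequality between the lengths. *)
Lemma count_tlts_transfer w w' (X : pred (nat -> nat -> bool)) phi psi :
    (forall P, border_tree_like w P -> X P ->
       border_tree_like w' (phi P) /\ psi (phi P) = P) ->
    (forall Q, border_tree_like w' Q ->
       [/\ border_tree_like w (psi Q), X (psi Q) & phi (psi Q) = Q]) ->
  count (fun T => X (pointed T)) (tlts w) = size (tlts w').
Proof.
move=> H1 H2; rewrite -size_filter.
pose f T := mkfilling (border_shape w') (phi (pointed T)).
pose g T := mkfilling (border_shape w) (psi (pointed T)).
apply/eqP; rewrite eqn_leq; apply/andP; split.
  apply: (leq_size_transfer (f := f) (g := g)).
    by rewrite filter_uniq ?uniq_tlts.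
  move=> T; rewrite mem_filter => /andP[XT /tltsP[sT tT]].
  have [t1 e1] := H1 _ tT XT; have pf := pointed_mkfilling t1.1.
  split; first by apply/tltsP; rewrite shape_mkfilling pf.
  have [s1 _] := tT.
  by rewrite /g; apply: eq_filling; rewrite ?shape_mkfilling ?pf ?e1 ?pointed_mkfilling.
apply: (leq_size_transfer (f := g) (g := f)); first exact: uniq_tlts.
move=> T /tltsP[sT tT].
have [t1 XT e1] := H2 _ tT; have pf := pointed_mkfilling t1.1.
split.
  by rewrite mem_filter /= pf XT; apply/tltsP; rewrite shape_mkfilling pf.
have [s1 _] := tT.
by rewrite /f; apply: eq_filling; rewrite ?shape_mkfilling ?pf ?e1 ?pointed_mkfilling.
Qed.

End Words.

(** * Removing a corner *)

Section CornerRemoval.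
Variables u v : seq bool.
Let w := u ++ [:: true, false & v].
Let i := nrow u.
Let j := ncol v.
Implicit Types P Q : nat -> nat -> bool.

(** Were the corner the root cell, [u] would have only horizontal steps and [v] only vertical ones,
    so any letter of [u] or [v] would close an empty column or row. *)
Lemma corner_nonroot P :
  0 < size u + size v -> border_tree_like w P -> (i, j) != (0, 0).
Proof.
move=> uv [supp [_ _ Pr Pc]]; apply/negP; rewrite xpair_eqE => /andP[/eqP i0 /eqP j0].
have rowE k : nth 0 (border_shape w) k = nth 0 (border_shape [:: true, false & v]) k.
  by rewrite nth_border_shape_cat -/i i0 subn0.
have [nu|nu] := posnP (size u).
  case: (Pr 1) => [|b /supp].
    by move: (nrow_ncol v); rewrite -/j j0 nrow_cat /nrow /= -/(nrow v); lia.
  by rewrite /wcell rowE /= ltnNge (leq_trans (nth_border_shape_le _ _)) // -/j j0.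
case: (Pc 1) => [|b /supp].
  by move: (nrow_ncol u); rewrite -/i i0 ncol_cat /ncol /= -/(ncol v); lia.
rewrite /wcell rowE ltnNge (leq_trans (nth_border_shape_le _ _)) //.
by rewrite /ncol /= -/(ncol v) -/j j0.
Qed.

Lemma count_empty_corner :
  count (fun T => ~~ pointed T i j) (tlts w) =
  size (tlts (u ++ [:: false, true & v])).
Proof.
have r : nrow (u ++ [:: false, true & v]) = nrow w by rewrite !nrow_cat.
have c : ncol (u ++ [:: false, true & v]) = ncol w by rewrite !ncol_cat.
apply: (@count_tlts_transfer _ _ (fun P => ~~ P i j) id id).
- move=> P [supp tP] Pij; split=> //; split; last by rewrite r c.
  move=> k l Pkl; rewrite wcell_swap supp //=.
  by apply: contraNneq Pij => -[ki lj]; move: Pkl; rewrite ki lj.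
- move=> Q [supp tQ]; split=> //; last first.
    by apply/negP => /supp; rewrite wcell_swap eqxx andbF.
  split; last by rewrite -r -c.
  by move=> k l /supp; rewrite wcell_swap => /andP[].
Qed.

(** A pointed corner with a point above has none to its left, hence is alone in its row, and no cell
    lies below it: its row can be deleted. *)
Lemma count_corner_above :
  count (fun T => pointed T i j && above_in (pointed T) i j) (tlts w) =
  size (tlts (u ++ false :: v)).
Proof.
have r : nrow w = (nrow (u ++ false :: v)).+1.
  by rewrite !nrow_cat /nrow /=; lia.
have c : ncol (u ++ false :: v) = ncol w by rewrite !ncol_cat.
have ir : i <= nrow (u ++ false :: v) by rewrite nrow_cat leq_addr.
have jc : j < ncol w by rewrite ncol_cat /ncol /= -/(ncol v); lia.
pose del P i' j' : bool := P (bump i i') j'.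
pose ins Q i' j' : bool := if i' == i then j' == j else Q (unbump i i') j'.
apply: (@count_tlts_transfer _ _ (fun P => P i j && above_in P i j) del ins).
- move=> P [supp tP] /andP[Pij aP]; have [_ Px _ _] := tP.
  have nz : (i, j) != (0, 0).
    by case/aboveP: aP => k ki _; apply: contraTneq ki => -[-> _].
  have := Px _ _ Pij nz; rewrite aP /= => lP.
  have Pi j' : P i j' = (j' == j).
    apply/idP/eqP => [Pij'|-> //]; have := wcell_corner_row (supp _ _ Pij').
    rewrite -/j leq_eqVlt => /predU1P[] // j'j; case/negP: lP.
    by apply/leftP; exists j'.
  have Pj i' : i < i' -> ~~ P i' j.
    by move=> ii; apply/negP => /supp/wcell_corner_col; rewrite -/i leqNgt ii.
  split; last first.
    apply: functional_extensionality => k; apply: functional_extensionality => l.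
    rewrite /ins; case: eqP => [->|/eqP ki]; first by rewrite Pi.
    by rewrite /del unbumpKcond (negPf ki).
  split; first by move=> k l /supp; rewrite wcell_del_row.
  by rewrite c; apply/(delete_row Pi Pj ir jc); rewrite -r.
- move=> Q [supp tQ].
  have delK : del (ins Q) = Q.
    apply: functional_extensionality => k; apply: functional_extensionality => l.
    by rewrite /del /ins eq_sym (negPf (neq_bump _ _)) bumpK.
  have Pi j' : ins Q i j' = (j' == j) by rewrite /ins eqxx.
  have suppP : supported w (ins Q).
    move=> k l; rewrite /ins; case: eqP => [-> /eqP ->|/eqP ki /supp].
      exact: wcell_corner.
    by rewrite wcell_del_row unbumpKcond (negPf ki).
  have Pj i' : i < i' -> ~~ ins Q i' j.
    by move=> ii; apply/negP => /suppP/wcell_corner_col; rewrite -/i leqNgt ii.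
  (* Read backwards, the deletion also yields the point above the reinserted one. *)
  have [D1 D2] := delete_row Pi Pj ir jc.
  case: D2; first by rewrite c -[Q in tree_like Q]delK in tQ.
  by move=> tP aP; split=> //; [split; rewrite // r|rewrite Pi eqxx].
Qed.

(** A pointed corner that is not the root and has no point above has one to its left; it is alone in
    its column, which can be deleted. *)
Lemma count_corner_left : 0 < size u + size v ->
  count (fun T => pointed T i j && ~~ above_in (pointed T) i j) (tlts w) =
  size (tlts (u ++ true :: v)).
Proof.
move=> uv.
have c : ncol w = (ncol (u ++ true :: v)).+1.
  by rewrite !ncol_cat /ncol /=; lia.
have r : nrow (u ++ true :: v) = nrow w by rewrite !nrow_cat.
have jc : j <= ncol (u ++ true :: v) by rewrite ncol_cat leq_addl.
have ir : i < nrow w by rewrite nrow_cat /nrow /= -/(nrow u) -/i; lia.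
pose del P i' j' : bool := P i' (bump j j').
pose ins Q i' j' : bool := if j' == j then i' == i else Q i' (unbump j j').
apply: (@count_tlts_transfer _ _ (fun P => P i j && ~~ above_in P i j) del ins).
- move=> P [supp tP] /andP[Pij aP]; have [_ Px _ _] := tP.
  have := Px _ _ Pij (corner_nonroot uv (conj supp tP)).
  rewrite (negPf aP) /= => lP.
  have Pj i' : P i' j = (i' == i).
    apply/idP/eqP => [Pij'|-> //]; have := wcell_corner_col (supp _ _ Pij').
    rewrite -/i leq_eqVlt => /predU1P[] // ii; case/negP: aP.
    by apply/aboveP; exists i'.
  have Pi j' : j < j' -> ~~ P i j'.
    by move=> jj; apply/negP => /supp/wcell_corner_row; rewrite -/j leqNgt jj.
  split; last first.
    apply: functional_extensionality => k; apply: functional_extensionality => l.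
    rewrite /ins; case: eqP => [->|/eqP ki]; first by rewrite Pj.
    by rewrite /del unbumpKcond (negPf ki).
  split; first by move=> k l /supp; rewrite wcell_del_col.
  by rewrite r; apply/(delete_col Pj Pi ir jc); rewrite -c.
- move=> Q [supp tQ].
  have delK : del (ins Q) = Q.
    apply: functional_extensionality => k; apply: functional_extensionality => l.
    by rewrite /del /ins eq_sym (negPf (neq_bump _ _)) bumpK.
  have Pj i' : ins Q i' j = (i' == i) by rewrite /ins eqxx.
  have suppP : supported w (ins Q).
    move=> k l; rewrite /ins; case: eqP => [-> /eqP ->|/eqP ki /supp].
      exact: wcell_corner.
    by rewrite wcell_del_col unbumpKcond (negPf ki).
  have Pi j' : j < j' -> ~~ ins Q i j'.
    by move=> jj; apply/negP => /suppP/wcell_corner_row; rewrite -/j leqNgt jj.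
  have [D1 D2] := delete_col Pj Pi ir jc.
  case: D2; first by rewrite r -[Q in tree_like Q]delK in tQ.
  move=> tP _; split=> //; first by split; rewrite // c.
  rewrite Pj eqxx /=; apply/negP => /aboveP[k ki].
  by rewrite Pj ltn_eqF.
Qed.

(** The three terms count the tableaux whose corner is empty, pointed with a point to its left, and
    pointed with a point above. *)
Lemma size_tlts_corner : 0 < size u + size v ->
  size (tlts w) = size (tlts (u ++ [:: false, true & v]))
    + size (tlts (u ++ true :: v)) + size (tlts (u ++ false :: v)).
Proof.
move=> uv; rewrite -count_empty_corner -count_corner_left // -count_corner_above.
rewrite -(count_predC (fun T => pointed T i j)) addnC -addnA; congr (_ + _).
elim: (tlts w) => //= T s ->.
by case: (pointed T i j); case: (above_in (pointed T) i j) => /=; lia.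
Qed.

End CornerRemoval.

(** The leading horizontal step would close a column without cells. *)
Lemma tlts_false w : tlts (false :: w) = [::].
Proof.
case e: (tlts _) => [//|T s].
have /tltsP[_ [supp [_ _ _ Pc]]] : T \in tlts (false :: w) by rewrite e mem_head.
have [|i /supp] := Pc (ncol w); first by rewrite /ncol /= add1n.
by rewrite /wcell /= ltnNge nth_border_shape_le.
Qed.

Lemma tlts_rcons_true w : tlts (rcons w true) = [::].
Proof.
case e: (tlts _) => [//|T s].
have /tltsP[_ [supp [_ _ Pr _]]] : T \in tlts (rcons w true) by rewrite e mem_head.
have [|j /supp] := Pr (nrow w); first by rewrite -cats1 nrow_cat addn1.
by rewrite /wcell -cats1 nth_border_shape_cat ltnn subnn.
Qed.

(** * Counting corners *)

Notation ntlt w := (size (tlts w)).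

Lemma tlts_root : tlts [:: true; false] = [:: [:: [:: true]]].
Proof.
apply: perm_small_eq => //; apply: uniq_perm; rewrite ?uniq_tlts // => T.
rewrite inE; apply/tltsP/eqP => [[]|->].
  case: T => [|[|b []] []] //= _ [_ [P0 _ _ _]].
  by move: P0; rewrite /pointed /= => ->.
split=> //; split=> [[|i] [|j] //|]; try by rewrite /pointed /= ?nth_nil.
split=> // [[|i] [|j]|[]|[]] //; rewrite /pointed /= ?nth_nil //.
- by exists 0.
- by exists 0.
Qed.

Definition total m := \sum_(w <- words m) ntlt w.

(** This is $g(a,b)$; [row_col_step] is $h(a,c,b)$. *)
Definition row_step a b :=
  \sum_(u <- words a) \sum_(v <- words b) ntlt (u ++ true :: v).

Definition row_col_step a c b :=
  \sum_(u <- words a) \sum_(t <- words c) \sum_(v <- words b)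
    ntlt (u ++ true :: t ++ false :: v).

Lemma row_step0 a : row_step a 0 = 0.
Proof.
by rewrite /row_step big1 // => u _; rewrite big_seq1 cats1 tlts_rcons_true.
Qed.

Lemma total_row_step b : total b.+1 = row_step 0 b.
Proof.
rewrite /total sum_words_cons [X in _ + X]big1 => [|w _]; last by rewrite tlts_false.
by rewrite addn0 /row_step big_seq1.
Qed.

(** Expand the letter after the marked step on the left, and the one before it on the right. The
    terms $Z(uDDv)$ cancel, and $Z(uDEv)-Z(uEDv)$ is given by the corner relation. *)
Lemma row_step_shift a b :
  0 < a + b -> row_step a b.+1 = row_step a.+1 b + total (a + b).+1.
Proof.
move=> ab; rewrite /row_step /total sum_words_rcons -addnS sum_words_cat.
rewrite -!big_split; apply: eq_big_seq => u; rewrite mem_words => /eqP su.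
rewrite /= !sum_words_cons -!big_split; apply: eq_big_seq => v.
rewrite mem_words => /eqP sv.
by rewrite /= !cat_rcons size_tlts_corner ?su ?sv //; lia.
Qed.

(** Each move of the marked step towards the end, where $g$ vanishes, contributes one
    [total (a + b)]. *)
Lemma row_step_total a b : 1 < a + b -> row_step a b = b * total (a + b).
Proof.
elim: b a => [|b IH] a ab; first by rewrite row_step0.
rewrite row_step_shift; last by lia.
by rewrite IH ?addSnnS // mulSn addnC addnS.
Qed.

(** There are $n!$ tableaux of size $n$, here $n=m+1$. The border starts with a vertical step, so
    each total is some $g(0,b)$, that is, $b$ times the previous total. *)
Lemma totalE m : total m.+2 = m.+1`!.
Proof.
elim: m => [|m IH].
  rewrite total_row_step /row_step big_seq1 /= big_cons big_seq1.
  by rewrite (tlts_rcons_true [:: true] : tlts [:: true; true] = _) tlts_root.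
by rewrite total_row_step row_step_total // add0n IH.
Qed.

Lemma row_stepE a b : row_step a b = b * (a + b).-1`!.
Proof.
case: b => [|b]; first exact: row_step0.
case ab: (a + b) => [|m].
  (* The value $g(0,1)$ is out of reach of the recurrence; it equals [total 2]. *)
  have [-> ->] : a = 0 /\ b = 0 by lia.
  by rewrite -total_row_step totalE.
by rewrite row_step_total ?addnS ?ab // totalE.
Qed.

(** The corner relation again, now moving the marked horizontal step; the marked vertical step
    before it keeps the context nonempty. *)
Lemma row_col_step_shift a c b :
  row_col_step a c.+1 b = row_col_step a c b.+1 + row_step a (c.+1 + b).
Proof.
rewrite addSnnS /row_col_step /row_step -big_split; apply: eq_bigr => u _.
rewrite sum_words_rcons sum_words_cat -!big_split; apply: eq_bigr => t _ /=.
rewrite !sum_words_cons -!big_split; apply: eq_bigr => v _ /=.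
rewrite !cat_rcons -!cat_cons !catA size_tlts_corner; first by lia.
by rewrite size_cat /= addnS.
Qed.

Lemma row_col_step0 a c : row_col_step a c 0 = row_step a c.+1.
Proof.
apply: eq_bigr => u _; rewrite sum_words_rcons [X in X + _]big1 => [|t _].
  by rewrite add0n; apply: eq_bigr => t _; rewrite big_seq1 cats1.
by rewrite -rcons_cons -rcons_cat tlts_rcons_true.
Qed.

Lemma row_col_step_row_step a c b :
  row_col_step a c b = row_col_step a 0 (c + b) + c * row_step a (c + b).
Proof.
elim: c b => [|c IH] b; first by rewrite addn0.
by rewrite row_col_step_shift IH addSnnS mulSn; lia.
Qed.

Lemma sum_row_col_step m :
  6 * \sum_(a < m.+2) row_col_step a 0 (m.+2 - a.+1) = m.+2`! * m.+2.+4.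
Proof.
(* With $b=m+1-a$ this is $h(a,0,b)=g(a,b+1)-b\,g(a,b)$, the subtracted term being moved to the
   left. *)
have E (a : 'I_m.+2) : row_col_step a 0 (m.+2 - a.+1) +
    (m.+2 - a.+1) ^ 2 * m`! = (m.+2 - a.+1).+1 * m.+1`!.
  have := row_col_step_row_step a (m.+2 - a.+1) 0.
  rewrite row_col_step0 addn0 !row_stepE.
  have -> : (a + (m.+2 - a.+1).+1).-1 = m.+1 by have := ltn_ord a; lia.
  have -> : (a + (m.+2 - a.+1)).-1 = m by have := ltn_ord a; lia.
  by move=> ->; rewrite expnS expn1 mulnA.
have : \sum_(a < m.+2) (row_col_step a 0 (m.+2 - a.+1) +
    (m.+2 - a.+1) ^ 2 * m`!) = \sum_(a < m.+2) (m.+2 - a.+1).+1 * m.+1`!.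
  by apply: eq_bigr => a _; exact: E.
have sub (a : 'I_m.+2) : m.+2 - (m.+2 - a.+1).+1 = a by have := ltn_ord a; lia.
(* Reversing the order of summation makes $b$ the index. *)
rewrite big_split /= -!big_distrl /= [X in _ + X * _](reindex_inj rev_ord_inj) /=.
rewrite [X in _ = X * _](reindex_inj rev_ord_inj) /=.
under [X in _ + X * _]eq_bigr => a _ do rewrite sub.
under [X in _ = X * _]eq_bigr => a _ do rewrite sub.
have S2 k : 6 * \sum_(i < k.+1) i ^ 2 = k * k.+1 * k.*2.+1.
  elim: k => [|k IH]; first by rewrite big_ord1.
  by rewrite big_ord_recr /= mulnDr IH; lia.
have S1 k : 2 * \sum_(i < k) i.+1 = k * k.+1.
  elim: k => [|k IH]; first by rewrite big_ord0.
  by rewrite big_ord_recr /= mulnDr IH; lia.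
have := S2 m.+1; have := S1 m.+2; rewrite !factS.
set s1 := \sum_(i < _) i.+1; set s2 := \sum_(i < _) i ^ 2.
move: (\sum_(i < _) _) s1 s2 m`! => K s1 s2 F e1 e2 eK.
(* Multiplying by 6 lets both sums be replaced by their closed forms without division. *)
suff : 6 * K + (6 * s2) * F = 3 * ((2 * s1) * (m.+1 * F)) ->
  6 * K = m.+2 * (m.+1 * F) * m.+2.+4.
  by apply; lia.
by rewrite e1 e2 -muln2; nia.
Qed.

(** Each factor [true, false] gives the last cell of the row just closed. The default of [head]
    excludes a final vertical step. *)
Fixpoint wcorners (w : seq bool) : seq (nat * nat) :=
  if w is b :: w' then
    let r := if b then [seq (c.1.+1, c.2) | c <- wcorners w'] else wcorners w' in
    if b && ~~ head true w' then (0, (ncol w').-1) :: r else r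
  else [::].

Lemma uniq_wcorners w : uniq (wcorners w).
Proof.
elim: w => //= -[] w IH //=.
have inj : injective (fun c : nat * nat => (c.1.+1, c.2)).
  by move=> [? ?] [? ?] /= [-> ->].
case: ifP => _; rewrite /= map_inj_uniq ?IH ?andbT //.
by apply/mapP => -[].
Qed.

Lemma mem_wcorners w (i j : nat) :
  ((i, j) \in wcorners w) =
  [&& wcell w i j, ~~ wcell w i j.+1 & ~~ wcell w i.+1 j].
Proof.
elim: w i j => [|[] w IH] i j //=; first by rewrite /wcell nth_nil.
rewrite [wcell (true :: w) i.+1]/wcell /= -/(wcell w i j).
have inj : injective (fun c : nat * nat => (c.1.+1, c.2)).
  by move=> [? ?] [? ?] /= [-> ->].
case: i => [|i]; last first.
  have -> : ((i.+1, j) \in (if ~~ head true w then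
      (0, (ncol w).-1) :: [seq (c.1.+1, c.2) | c <- wcorners w]
      else [seq (c.1.+1, c.2) | c <- wcorners w])) =
    ((i.+1, j) \in [seq (c.1.+1, c.2) | c <- wcorners w]).
    by case: ifP; rewrite ?inE.
  by rewrite (mem_map inj _ (i, j)) IH.
have -> : ((0, j) \in (if ~~ head true w then
    (0, (ncol w).-1) :: [seq (c.1.+1, c.2) | c <- wcorners w]
    else [seq (c.1.+1, c.2) | c <- wcorners w])) =
  ~~ head true w && (j == (ncol w).-1).
  have no : ((0, j) \in [seq (c.1.+1, c.2) | c <- wcorners w]) = false.
    by apply/mapP => -[].
  by case: ifP; rewrite ?inE ?xpair_eqE no //= orbF.
rewrite /wcell /=; case: w {IH inj} => [|[] w] //=.
  by lia.
have := nth_border_shape_le w 0; rewrite /ncol /= -/(ncol w); lia.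
Qed.

(** The index [a] is the position of the factor. The weight [G] is arbitrary because the induction
    on the first letter replaces it by the sum of its two restrictions. *)
Lemma sum_size_wcorners m (G : seq bool -> nat) :
  \sum_(w <- words m.+1) G w * size (wcorners w) =
  \sum_(a < m) \sum_(u <- words a) \sum_(v <- words (m - a.+1))
     G (u ++ [:: true, false & v]).
Proof.
elim: m G => [|m IH] G; first by rewrite big_ord0 big_cons big_seq1 /= !muln0.
rewrite big_ord_recl sum_words_cons.
transitivity (\sum_(v <- words m) G [:: true, false & v] +
   \sum_(w <- words m.+1) (G (true :: w) + G (false :: w)) * size (wcorners w)).
  have -> : \sum_(v <- words m) G [:: true, false & v] =
      \sum_(w <- words m.+1) G (true :: w) * ~~ head true w.
    rewrite sum_words_cons [X in _ = X + _]big1 => [|v _]; last by rewrite muln0.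
    by rewrite add0n; apply: eq_bigr => v _; rewrite muln1.
  rewrite -!big_split; apply: eq_bigr => w _ /=.
  by case: (head true w); rewrite /= !size_map; lia.
rewrite IH; congr (_ + _); first by rewrite [RHS]big_seq1 subSS subn0.
apply: eq_bigr => a _; rewrite lift0.
rewrite [in RHS]sum_words_cons -big_split; apply: eq_bigr => u _.
by rewrite -big_split subSS.
Qed.

Lemma sum_corners m :
  6 * \sum_(w <- words m.+3) ntlt w * size (wcorners w) = m.+2`! * m.+2.+4.
Proof.
rewrite sum_size_wcorners -sum_row_col_step; congr (6 * _).
by apply: eq_bigr => a _; apply: eq_bigr => u _; rewrite big_seq1.
Qed.

(** * Counting runs of size 1 *)

(** The product [p * s] applies [p] first, so the reindexing permutes positions, not values. *)
Lemma sum_perm_premul n (p : 'S_n) (Q : 'S_n -> nat) :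
  \sum_s Q (p * s)%g = \sum_s Q s.
Proof. by rewrite [RHS](reindex_inj (mulgI p)). Qed.

Lemma sum_perm_gt2 n (a b : 'I_n) : a != b -> 2 * \sum_(s : 'S_n) (s b < s a) = n`!.
Proof.
move=> ab; rewrite -card_Sn -sum1_card mulSn mul1n.
rewrite -{1}(sum_perm_premul (tperm a b)) -big_split; apply: eq_bigr => s _ /=.
rewrite !permM tpermL tpermR.
have : val (s a) != s b by rewrite val_eqE (inj_eq perm_inj).
by case: ltngtP.
Qed.

(** The six orders of three entries are equally frequent, by exchanging positions, and each
    permutation realizes exactly one of them. *)
Lemma sum_perm_gt3 n (a b c : 'I_n) : a != b -> b != c -> a != c ->
  6 * \sum_(s : 'S_n) ((s b < s a) && (s c < s b)) = n`!.
Proof.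
pose A (x y z : 'I_n) := \sum_(s : 'S_n) ((s y < s x) && (s z < s y)).
move=> ab bc ac; rewrite -/(A a b c) -card_Sn -sum1_card.
have tL x y z : x != z -> y != z -> A y x z = A x y z.
  move=> xz yz; rewrite /A -(sum_perm_premul (tperm x y)); apply: eq_bigr => s _.
  by rewrite !permM tpermL tpermR tpermD // eq_sym.
have tR x y z : x != y -> x != z -> A x z y = A x y z.
  move=> xy xz; rewrite /A -(sum_perm_premul (tperm y z)); apply: eq_bigr => s _.
  by rewrite !permM tpermL tpermR tpermD // eq_sym.
have [ba cb ca] : [/\ b != a, c != b & c != a] by rewrite ![_ == a]eq_sym [c == b]eq_sym.
transitivity (A a b c + A b a c + A a c b + A b c a + A c a b + A c b a).
  have e1 := tL a b c ac bc; have e2 := tR a b c ab ac.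
  have e3 := tR b a c ba bc; have e4 := tL a c b ab cb.
  have e5 := tL b c a ba ca; lia.
rewrite -!big_split; apply: eq_bigr => s _ /=.
have : val (s a) != s b by rewrite val_eqE (inj_eq perm_inj).
have : val (s b) != s c by rewrite val_eqE (inj_eq perm_inj).
have : val (s a) != s c by rewrite val_eqE (inj_eq perm_inj).
move=> /=; lia.
Qed.

Section Runs.
Variable n : nat.
Implicit Type s : 'S_n.

Lemma entry_ord s (i : 'I_n) : entry s i.+1 = (s i).+1.
Proof. by rewrite /entry valK. Qed.

Lemma entry_last s : entry s n.+1 = 0.
Proof. by rewrite /entry insubF ?ltnn. Qed.

Lemma is_run1E s k :
  is_run s k 1 =
  [&& 0 < k, k <= n, entry s k < entry s k.-1 & entry s k.+1 < entry s k].
Proof.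
rewrite /is_run addn1 ltnS /=; congr [&& _, _, _ & _].
(* The ascent condition of a run of size 1 ranges over the empty type ['I_0]. *)
by case: forallP => // -[] [].
Qed.

(** The convention $\sigma_0=n+1$ makes the first inequality automatic; only the descent to the
    second letter remains. *)
Lemma sum_run_first (a b : 'I_n) : val a = 0 -> val b = 1 ->
  2 * \sum_(s : 'S_n) is_run s 1 1 = n`!.
Proof.
move=> a0 b1; have ab : a != b by rewrite -val_eqE a0 b1.
rewrite -(sum_perm_gt2 ab); congr (2 * _); apply: eq_bigr => s _.
rewrite is_run1E; have := entry_ord s a; have := entry_ord s b.
rewrite a0 b1 => -> -> /=.
by have := ltn_ord (s a); have := ltn_ord a; lia.
Qed.

Lemma sum_run_last (a b : 'I_n) : n = b.+1 -> val b = a.+1 ->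
  2 * \sum_(s : 'S_n) is_run s n 1 = n`!.
Proof.
move=> nb ba; have ab : a != b by rewrite -val_eqE ba ltn_eqF.
rewrite -(sum_perm_gt2 ab); congr (2 * _); apply: eq_bigr => s _.
have eb : entry s n = (s b).+1 by rewrite -entry_ord; congr entry.
have ea : entry s n.-1 = (s a).+1.
  by rewrite -entry_ord -ba; congr (entry s _); apply: (congr1 predn nb).
by rewrite is_run1E entry_last eb ea leqnn (leq_ltn_trans (leq0n b)) // andbT.
Qed.

Lemma sum_run_middle (a b c : 'I_n) : val b = a.+1 -> val c = b.+1 ->
  6 * \sum_(s : 'S_n) is_run s c 1 = n`!.
Proof.
move=> ba cb; rewrite -(@sum_perm_gt3 _ a b c); first last.
- by rewrite -val_eqE cb [X in X.+1]ba ltn_eqF // ltnW.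
- by rewrite -val_eqE cb ltn_eqF.
- by rewrite -val_eqE ba ltn_eqF.
congr (6 * _); apply: eq_bigr => s _.
have eb : entry s c = (s b).+1 by rewrite -entry_ord -cb.
have ea : entry s c.-1 = (s a).+1.
  by rewrite -entry_ord -ba; congr (entry s _); apply: (congr1 predn cb).
rewrite is_run1E entry_ord eb ea (ltnW (ltn_ord c)) !ltnS.
by rewrite (leq_ltn_trans (leq0n b)) //= -cb.
Qed.

End Runs.

Lemma sum_runs m :
  6 * \sum_(k < m.+2) \sum_(s : 'S_m.+2) is_run s k.+1 1 = m.+2`! * m.+2.+4.
Proof.
have first := @sum_run_first m.+2 ord0 (inord 1) erefl (inordK (isT : 1 < m.+2)).
have last := @sum_run_last m.+2 (inord m) ord_max erefl
  (congr1 succn (esym (inordK (leqnSn m.+1)))).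
(* The two ends contribute $3\,n!$ each and the $m$ middle positions $n!$ each, where $m+6=n+4$. *)
rewrite big_ord_recl big_ord_recr /= !mulnDr.
rewrite -[6]/(3 * 2) -mulnA first -[3 * 2 * \sum_s is_run s m.+2 1]mulnA last.
rewrite big_distrr /= (eq_bigr (fun=> m.+2`!)) => [|i _].
  by rewrite sum_nat_const card_ord; lia.
have i2 : i.+2 < m.+2 := ltn_ord i; have i1 := ltnW i2; have i0 := ltnW i1.
have := @sum_run_middle m.+2 (inord i) (inord i.+1) (inord i.+2).
rewrite /= !inordK // => mid.
by rewrite -(mid erefl erefl).
Qed.

Lemma sum_runs1 : \sum_(s : 'S_1) is_run s 1 1 = 1.
Proof.
rewrite (eq_bigr (fun=> 1)) => [|s _].
  by rewrite sum1_card card_Sn.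
by rewrite is_run1E entry_last -[1]/((@ord0 0).+1) entry_ord (ord1 (s _)).
Qed.

(** * The bijection *)

Lemma bij_of_enum (A B : eqType) (s : seq A) (t : seq B) :
    uniq s -> uniq t -> (forall a, a \in s) -> (forall b, b \in t) ->
  size s = size t -> exists f : A -> B, bijective f.
Proof.
(* Empty types are treated apart, since [nth] needs a default element. *)
case: s t => [|a0 s] [|b0 t] // us ut As Bt st.
  exists (fun a => match notF (As a) with end).
  by exists (fun b => match notF (Bt b) with end) => x; [have := As x|have := Bt x].
exists (fun a => nth b0 (b0 :: t) (index a (a0 :: s))).
exists (fun b => nth a0 (a0 :: s) (index b (b0 :: t))).
- by move=> a; rewrite index_uniq ?nth_index // -st index_mem.
- by move=> b; rewrite index_uniq ?nth_index // st index_mem.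
Qed.

(** The row lengths do not record the leading horizontal steps; the number of columns does. *)
Lemma border_shape_inj w w' :
  border_shape w = border_shape w' -> ncol w = ncol w' -> w = w'.
Proof.
have lt x y : border_shape (true :: x) = border_shape y -> ncol x <= ncol y.
  move=> /= e; have := nth_border_shape_le y 0; by rewrite -e.
elim: w w' => [|b w IH] [|b' w'] //=; first by case: b'.
  by case: b.
case: b b' => -[] //=.
- by move=> [_ e]; rewrite /ncol /= => c; rewrite (IH w').
- by move=> /(lt w); rewrite /ncol /= => h1 h2; lia.
- by move/esym => /(lt w'); rewrite /ncol /= => h1 h2; lia.
- by move=> e; rewrite /ncol /= => /addnI c; rewrite (IH w').
Qed.

Lemma path_border_shape w k : ncol w <= k -> path geq k (border_shape w).
Proof.
elim: w k => //= -[] w IH k; rewrite /ncol /= -/(ncol w) => h.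
  by rewrite h IH.
by apply: IH; lia.
Qed.

Lemma border_shape_surj sh : sorted geq sh ->
  exists2 w, border_shape w = sh & ncol w = head 0 sh.
Proof.
elim: sh => [_|k sh IH] /=; first by exists [::].
move=> ksh; have [w e c] := IH (path_sorted ksh).
have wk : ncol w <= k by rewrite c; case: sh ksh {IH e c} => //= ? ? /andP[].
(* The added horizontal steps close the columns reached by the new top row only. *)
exists (true :: nseq (k - ncol w) false ++ w).
  rewrite /= ncol_cat /ncol count_nseq /= mul1n subnK //; congr (_ :: _).
  by elim: (k - _).
by rewrite /ncol /= count_cat count_nseq /= mul1n subnK.
Qed.

Lemma npointsE T C : (forall i j, pointed T i j -> j < C) ->
  npoints T = \sum_(i < size T) \sum_(j < C) pointed T i j.
Proof.
rewrite /npoints => b; rewrite count_flatten sumnE big_map (big_nth [::]) big_mkord.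
apply: eq_bigr => i _; have {b} : forall j, nth false (nth [::] T i) j -> j < C := b i.
rewrite /pointed; elim: (nth [::] T i) C => [|p r IH] C b.
  by rewrite big1 // => j _; rewrite nth_nil.
case: C b => [|C] b; last first.
  by rewrite big_ord_recl /= (IH C) // => j /(b j.+1).
rewrite big_ord0; apply/eqP; rewrite -leqn0 leqNgt -has_count; apply/negP.
by move=> /(has_nthP false)[j _ /b].
Qed.

(** The last column has a cell in some row, and the top row is at least as long as that row. *)
Lemma tlts_ncols w T : T \in tlts w -> ncols T = ncol w.
Proof.
case/tltsP=> sT [supp [P0 _ _ Pc]]; rewrite /ncols sT.
apply/eqP; rewrite eqn_leq -nth0 nth_border_shape_le /=.
have /andP[_ c0] := wcell_bound (supp _ _ P0).
have [|i /supp] := Pc (ncol w).-1; first by rewrite prednK.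
rewrite /wcell prednK // => /leq_trans; apply.
have := @path_border_shape w (ncol w) (leqnn _).
case: (border_shape w) => [|k sh /= /andP[_]]; first by rewrite !nth_nil.
have tr : transitive geq by move=> x y z /= xy yz; apply: leq_trans yz xy.
move=> /(order_path_min tr)/allP kmin; case: i => //= i.
case: (ltnP i (size sh)) => ish; last by rewrite nth_default.
exact/kmin/mem_nth.
Qed.

(** By [card_points], rows and columns together exceed the points by one, and their number is the
    border length. *)
Lemma tltsE n T : is_tree_like T && (npoints T == n) <->
  exists2 w, size w = n.+1 & T \in tlts w.
Proof.
have npE w : T \in tlts w -> (npoints T).+1 = size w.
  case/tltsP=> sT [supp tT].
  have sz : size T = nrow w by rewrite -(size_map size) -/(shape T) sT size_border_shape.
  have b i j : pointed T i j -> (i < nrow w) && (j < ncol w) by move=> /supp/wcell_bound.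
  rewrite (@npointsE T (ncol w)) => [|i j /b/andP[] //].
  have /andP[r0 c0] := b 0 0 (let: And4 h _ _ _ := tT in h).
  by rewrite sz card_points // nrow_ncol.
have tE : is_tree_like T = is_diagram T && tree_likeb T (size T) (ncols T) by [].
split=> [/andP[tT /eqP nT]|[w sw wT]].
  move: tT; rewrite tE => /andP[/andP[sT _] tT].
  have [w ew cw] := border_shape_surj sT.
  have wT : T \in tlts w.
    rewrite mem_filter mem_fillings ew eqxx andbT cw.
    by rewrite -size_border_shape ew size_map.
  by exists w; rewrite // -(npE _ wT) nT.
rewrite -eqSS (npE _ wT) sw eqxx andbT tE.
have [sT [supp tT]] := tltsP _ _ wT.
have sz : size T = nrow w by rewrite -(size_map size) -/(shape T) sT size_border_shape.
move: (wT); rewrite mem_filter sz (tlts_ncols wT) => /andP[-> _].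
rewrite andbT /is_diagram sT (path_sorted (path_border_shape (leqnn (ncol w)))) /=.
apply/negP => /(nthP 0)[i iw i0]; case: tT => _ _ Pr _.
have [|j /supp] := Pr i; first by rewrite -size_border_shape.
by rewrite /wcell i0.
Qed.

(** * Enumeration of the two sets *)

Definition all_tlts n := [seq T | w <- words n.+1, T <- tlts w].

Lemma mem_all_tlts n T : (T \in all_tlts n) = is_tree_like T && (npoints T == n).
Proof.
apply/allpairsPdep/idP => [[w [T' [+ wT ->]]]|/tltsE[w sw wT]].
  by rewrite mem_words => /eqP sw; apply/tltsE; exists w.
by exists w, T; rewrite mem_words sw.
Qed.

Lemma uniq_all_tlts n : uniq (all_tlts n).
Proof.
apply: allpairs_uniq_dep => [|w _|]; rewrite ?uniq_words ?uniq_tlts //.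
move=> _ _ /allpairsPdep[w [T [_ wT ->]]] /allpairsPdep[w' [T' [_ wT' ->]]] /= e.
rewrite -e in wT' *; have -> // : w = w'.
apply: border_shape_inj; last by rewrite -(tlts_ncols wT) (tlts_ncols wT').
by case/tltsP: wT => <- _; case/tltsP: wT' => <- _.
Qed.

(** A square containing every cell of a diagram with border length [n], so that corners form a
    finite list. *)
Definition box n := [seq (i, j) | i <- iota 0 n, j <- iota 0 n].

Lemma corner_box n w T c : size w = n -> T \in tlts w -> corner T c -> c \in box n.
Proof.
move=> sw /tltsP[sT _]; rewrite /corner /cell sT => /andP[/wcell_bound/andP[iw jw] _].
have := nrow_ncol w; rewrite sw => e.
by apply/allpairsP; exists c; case: c iw jw => i j; rewrite !mem_iota /=; split=> //; lia.
Qed.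

Lemma count_corner n w T : size w = n -> T \in tlts w ->
  count (corner T) (box n) = size (wcorners w).
Proof.
move=> sw wT; rewrite -size_filter; apply/perm_size/uniq_perm.
- apply/filter_uniq/allpairs_uniq; rewrite ?iota_uniq //.
  by move=> [? ?] [? ?] _ _ /= [-> ->].
- exact: uniq_wcorners.
move=> [i j]; rewrite mem_filter andb_idr => [|/(corner_box sw wT) //].
by have [sT _] := tltsP _ _ wT; rewrite mem_wcorners /corner /cell sT.
Qed.

Definition enum_tlt n : seq (tlt n) := pmap insub (all_tlts n).

Definition enum_tlt_corner n : seq (tlt_corner n) :=
  pmap insub [seq (t, c) | t <- enum_tlt n, c <- box n.+1].

Lemma size_enum_tlt_corner n :
  size (enum_tlt_corner n) = \sum_(w <- words n.+1) ntlt w * size (wcorners w).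
Proof.
rewrite size_pmap_sub -sum1_count big_mkcond big_allpairs_dep.
transitivity (\sum_(T <- map val (enum_tlt n)) count (corner T) (box n.+1)).
  by rewrite big_map; apply: eq_bigr => t _; rewrite -sum1_count [RHS]big_mkcond.
(* Here [insub] discards nothing, as all listed fillings are tableaux of size [n]. *)
rewrite (pmap_filter (insubK _)) (eq_in_filter (a2 := predT)) ?filter_predT.
  rewrite big_allpairs_dep; apply: eq_big_seq => w; rewrite mem_words => /eqP sw.
  rewrite -sum1_size big_distrl; apply: eq_big_seq => T wT.
  by rewrite (count_corner sw wT); apply/esym/mul1n.
by move=> T; rewrite mem_all_tlts => tT /=; rewrite insubT.
Qed.

Definition enum_run1 n : seq (run1 n) :=
  pmap insub [seq (s, k) | s <- enum 'S_n, k <- iota 1 n].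

Lemma size_enum_run1 n :
  size (enum_run1 n) = \sum_(k < n) \sum_(s : 'S_n) is_run s k.+1 1.
Proof.
rewrite size_pmap_sub -sum1_count big_mkcond big_allpairs_dep /= exchange_big /=.
rewrite -[1]addn0 iotaDl big_map -{1}[n]subn0 -/(index_iota 0 n) big_mkord.
apply: eq_bigr => k _; rewrite big_enum /=; apply: eq_big => [s|s _].
  by rewrite inE.
by rewrite add1n; case: is_run.
Qed.

Theorem theorem3p4 (n : nat) (hn : 1 <= n) :
  exists f : tlt_corner n -> run1 n, bijective f.
Proof.
apply: (@bij_of_enum _ _ (enum_tlt_corner n) (enum_run1 n)).
- rewrite pmap_sub_uniq // allpairs_uniq ?pmap_sub_uniq ?uniq_all_tlts //.
    by rewrite allpairs_uniq ?iota_uniq // => -[? ?] [? ?] _ _ /= [-> ->].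
  by move=> [? ?] [? ?] _ _ /= [-> ->].
- rewrite pmap_sub_uniq // allpairs_uniq ?enum_uniq ?iota_uniq //.
  by move=> [? ?] [? ?] _ _ /= [-> ->].
- move=> [[t c] tc]; rewrite mem_pmap_sub.
  apply/allpairsP; exists (t, c); split=> //.
    by rewrite mem_pmap_sub mem_all_tlts (valP t).
  have /tltsE[w sw wT] := valP t.
  exact: (corner_box sw wT tc).
- move=> [[s k] sk]; rewrite mem_pmap_sub.
  apply/allpairsP; exists (s, k); split; rewrite ?mem_enum //= mem_iota.
  by move: sk; rewrite is_run1E => /and4P[-> kn _ _]; rewrite add1n ltnS.
rewrite size_enum_tlt_corner size_enum_run1.
(* For $n=1$ both totals are 1, which $n!(n+4)/6$ does not give. *)
case: n hn => [//|[|m]] _.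
  by rewrite sum_size_wcorners !big_ord1 !big_seq1 /= tlts_root sum_runs1.
by apply/eqP; rewrite -(eqn_pmul2l (isT : 0 < 6)) sum_corners sum_runs.
Qed.
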